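(* Let $\alpha>1$. The generalized Airy function $$\mathrm{Ai}_{\alpha}(x)=\frac{1}{\pi}\int_0^{+\infty}\cos\left(xs+\frac{s^\alpha}{\alpha}\right)ds$$ (a convergent improper integral) admits, for $x\in\mathbb{R}$, the power series representation $$\mathrm{Ai}_{\alpha}(x)=\frac{1}{\pi\alpha^{\frac{\alpha-1}{\alpha}}}\sum_{k=0}^{\infty}\frac{x^k\alpha^{\frac{k}{\alpha}}}{k!}\,\Gamma\left(\frac{k+1}{\alpha}\right)\sin\left(\pi\frac{(k+1)(\alpha+1)}{2\alpha}\right).$$
   Context: $\alpha$ is a real number, not necessarily an integer. $\Gamma$ is the Euler gamma function. The integral is understood as $\lim_{c\to+\infty}\int_0^c$. *)

(* Defs.v *)
From mathcomp Require Import all_boot all_order all_algebra.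
From mathcomp Require Import all_classical all_reals all_analysis.

Set Implicit Arguments.
Unset Strict Implicit.
Unset Printing Implicit Defensive.

Import Order.TTheory GRing.Theory Num.Theory.
Import numFieldNormedType.Exports.

Local Open Scope classical_set_scope.
Local Open Scope ring_scope.

(* Euler's integral, which is the Gamma function for z > 0 only.  The integrand
   is nonnegative, so the Lebesgue integral over ]0, +oo[ agrees with the
   improper integral (singular at 0 when z < 1). *)
Definition Gamma (R : realType) (z : R) : R :=
  \int[lebesgue_measure]_(t in `]0, +oo[) (t `^ (z - 1) * expR (- t)).

Definition Airy_integral (R : realType) (alpha x c : R) : R :=
  \int[lebesgue_measure]_(s in `[0, c]) cos (x * s + s `^ alpha / alpha).

(* The integrand is not absolutely integrable on [0, +oo[, so the integral is
   the limit of the proper ones, not a Lebesgue integral over the half-line.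
   [lim] is meaningful only when that limit exists. *)
Definition Airy (R : realType) (alpha x : R) : R :=
  pi^-1 * lim (Airy_integral alpha x c @[c --> +oo]).

Definition Airy_term (R : realType) (alpha x : R) (k : nat) : R :=
  x ^+ k * alpha `^ (k%:R / alpha) / k`!%:R
  * Gamma (k.+1%:R / alpha)
  * sin (pi * (k.+1%:R * (alpha + 1)) / (2 * alpha)).

(* Main.v *)
Require Import Defs.
From mathcomp Require Import all_boot all_order all_algebra.
From mathcomp Require Import all_classical all_reals all_analysis.
From mathcomp Require Import measurable_realfun ring lra.

Import Order.TTheory GRing.Theory Num.Theory.
Import numFieldNormedType.Exports.

Local Open Scope classical_set_scope.
Local Open Scope ring_scope.

(** With g(z) = exp (i (x z + z^a / a)), the integral to compute is the real
    part of that of g over [0, +oo[. Rotating the half-line by the angle phi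
    gives F(phi, c) = \int_0^c Re (e^{i phi} g(t e^{i phi})) dt. The derivatives
    of e^{i phi} g(t e^{i phi}) in phi and of i t e^{i phi} g(t e^{i phi}) in t
    coincide, so that d/dphi F(phi, c) = Re (i c e^{i phi} g(c e^{i phi})).
    For phi in [0, pi / (2 a)] and c large this is at most
    c exp (- phi c^a / 4), whose integral in phi is O(c^(1 - a)). Hence the limit
    is the same at phi = pi / (2 a), where g decays like exp (- t^a / a):
    there one expands e^{i x z} and integrates term by term, the moments of
    exp (- t^a / a) being Gamma values. *)

(** * Elementary inequalities by comparison of derivatives *)

Lemma is_derive_le (R : realType) (f g f' g' : R -> R) (a b : R) : a <= b ->
  (forall y, a <= y <= b -> is_derive y 1 f (f' y)) ->
  (forall y, a <= y <= b -> is_derive y 1 g (g' y)) ->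
  (forall y, a <= y <= b -> f' y <= g' y) ->
  f b - f a <= g b - g a.
Proof.
move=> ab df dg fg.
have dh y : a <= y <= b -> is_derive y 1 (g - f) (g' y - f' y).
  by move=> yab; apply: is_deriveB; [exact: dg|exact: df].
have ch : {within `[a, b], continuous (g - f)}.
  apply: derivable_within_continuous => y; rewrite in_itv/= => yab.
  exact: (@ex_derive _ _ _ _ _ _ _ (dh y yab)).
have oo y : y \in `]a, b[ -> a <= y <= b.
  by rewrite in_itv/= => /andP[/ltW -> /ltW ->].
have := @ger0_derive1_le_cc R (g - f) a b _ _ ch a b.
rewrite !in_itv/= !lexx ab => /(_ _ _ isT isT isT) h.
have : (g - f) a <= (g - f) b.
  apply: h => y /oo yab; first exact: (@ex_derive _ _ _ _ _ _ _ (dh y yab)).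
  have dhy := dh y yab.
  by rewrite derive1E derive_val subr_ge0 fg.
by rewrite !fctE; lra.
Qed.

(** Stands in for bounding the integral of [|f'|]: an explicit primitive [g] of the bound is enough,
    so no integral of [f'] is ever formed. *)
Lemma is_derive_norm_le (R : realType) (f g f' g' : R -> R) (a b : R) : a <= b ->
  (forall y, a <= y <= b -> is_derive y 1 f (f' y)) ->
  (forall y, a <= y <= b -> is_derive y 1 g (g' y)) ->
  (forall y, a <= y <= b -> `|f' y| <= g' y) ->
  `|f b - f a| <= g b - g a.
Proof.
move=> ab df dg fg; rewrite ler_norml; apply/andP; split; last first.
  by apply: is_derive_le ab df dg _ => y /fg; rewrite ler_norml => /andP[].
have : - f b - - f a <= g b - g a; last by lra.
apply: (@is_derive_le R (- f) g (- f') g') => // y yab.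
- by apply: is_deriveN; exact: df.
- by move: (fg y yab); rewrite ler_norml => /andP[+ _]; rewrite lerNl.
Qed.

Lemma norm_sin_le (R : realType) (u : R) : 0 <= u -> `|sin u| <= u.
Proof.
move=> u0; have := @is_derive_norm_le R sin id cos (fun=> 1) 0 u u0.
rewrite sin0 !subr0; apply => y _; exact: cos_max.
Qed.

(** A division-free form of u <= tan u, obtained from (u cos u)' = cos u - u sin u <= cos u. *)
Lemma sin_ge_mul_cos (R : realType) (u : R) :
  0 <= u <= pi -> u * cos u <= sin u.
Proof.
move=> /andP[u0 upi].
have : u * cos u - 0 * cos 0 <= sin u - sin 0.
  apply: (@is_derive_le R (fun y => y * cos y) sin
    (fun y => cos y - y * sin y) cos) => // y /andP[y0 yu].
    by apply: is_derive_eq; rewrite /GRing.scale/=; lra.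
  by rewrite gerBl mulr_ge0// sin_ge0_pi// y0 (le_trans yu).
by rewrite sin0 mul0r !subr0.
Qed.

(** A weak Jordan inequality by halving the angle: with v = u / 2, sin u = 2 sin v cos v >= 2 v (cos
    v)^2 = v (1 + cos u) >= v. *)
Lemma sin_ge_half (R : realType) (u : R) : 0 <= u <= pi / 2 -> u / 2 <= sin u.
Proof.
move=> /andP[u0 upi]; have pi0 := pi_gt0 R.
have c0 : 0 <= cos (u / 2) by apply: cos_ge0_pihalf; lra.
have : 0 <= cos u by apply: cos_ge0_pihalf; lra.
have {1 3}-> : u = u / 2 *+ 2 by rewrite mulr2n; lra.
rewrite cos_mulr2n sin_mulr2n.
have : u / 2 * cos (u / 2) <= sin (u / 2) by apply: sin_ge_mul_cos; lra.
move: c0; set c := cos _; set s := sin _; set v := u / 2 => c0 h cc.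
have v0 : 0 <= v by rewrite /v; lra.
have := ler_wpM2l c0 h; have := mulr_ge0 v0 cc.
by rewrite !mulr2n; lra.
Qed.

(** * Taylor remainder of the exponential along a ray *)

Lemma is_derive_expMl (R : realType) (x y : R) (n : nat) :
  is_derive y 1 (fun s => (x * s) ^+ n.+1) (n.+1%:R * x * (x * y) ^+ n).
Proof.
have -> : (fun s => (x * s) ^+ n.+1) = ( *%R x) ^+ n.+1 by rewrite exprfctE.
apply: is_derive_eq; rewrite /GRing.scale/=; ring.
Qed.

(* This is the real part of the expansion of exp (i g + x t e^{i b}).
   The remainder of order n + 1 has x times the remainder of order n with g
   shifted by b as its derivative. *)
Lemma expR_cos_taylor (R : realType) (x b : R) (n : nat) (t g : R) : 0 <= t ->
  `|expR (x * t * cos b) * cos (g + x * t * sin b)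
    - \sum_(k < n) (x * t) ^+ k / k`!%:R * cos (g + k%:R * b)|
  <= expR (`|x| * t) * ((`|x| * t) ^+ n / n`!%:R).
Proof.
elim: n t g => [|n IH] t g t0.
  rewrite big_ord0 subr0 expr0 fact0 divr1 mulr1 normrM ger0_norm ?expR_ge0//.
  rewrite -[leRHS]mulr1 ler_pM ?expR_ge0 ?cos_max// ler_expR.
  apply: (le_trans (ler_norm _)); rewrite !normrM (ger0_norm t0).
  by rewrite ler_piMr ?cos_max ?mulr_ge0.
pose f s := expR (x * s * cos b) * cos (g + x * s * sin b)
    - \sum_(k < n.+1) (x * s) ^+ k / k`!%:R * cos (g + k%:R * b).
pose h s := expR (`|x| * s) * ((`|x| * s) ^+ n.+1 / n.+1`!%:R).
pose f' s := x * (expR (x * s * cos b) * cos (g + b + x * s * sin b)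
    - \sum_(k < n) (x * s) ^+ k / k`!%:R * cos (g + b + k%:R * b)).
(* The product rule gives [|x|] times the induction bound plus a nonnegative term, which is
   discarded at the end. *)
pose h' s := `|x| * (expR (`|x| * s) * ((`|x| * s) ^+ n / n`!%:R)) +
  `|x| * (expR (`|x| * s) * ((`|x| * s) ^+ n.+1 / n.+1`!%:R)).
have f0 : f 0 = 0.
  rewrite /f mulr0 !mul0r expR0 addr0 mul1r big_ord_recl/= big1.
    by rewrite expr0 fact0 divr1 mul1r mul0r !addr0 subrr.
  by move=> k _; rewrite expr0n/= !mul0r.
have h0 : h 0 = 0 by rewrite /h mulr0 expr0n/= mul0r mulr0.
have invfact k : (k`!%:R)^-1 = k.+1%:R / k.+1`!%:R :> R.
  by rewrite factS natrM invfM mulrA divff ?mul1r// pnatr_eq0.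
suff : `|f t - f 0| <= h t - h 0 by rewrite f0 h0 !subr0.
apply: (@is_derive_norm_le R f h f' h') => // y /andP[y0 yt].
- rewrite /f /f'.
  have -> : (fun s => expR (x * s * cos b) * cos (g + x * s * sin b)
    - \sum_(k < n.+1) (x * s) ^+ k / k`!%:R * cos (g + k%:R * b)) =
    (fun s => expR (x * s * cos b) * cos (g + x * s * sin b)) -
    \sum_(k < n.+1) (fun s => (x * s) ^+ k / k`!%:R * cos (g + k%:R * b)).
    by apply/funext => s; rewrite !fctE fct_sumE.
  rewrite mulrBr mulr_sumr; apply: is_deriveB.
    apply: is_derive_eq; rewrite /GRing.scale/=.
    have -> : g + b + x * y * sin b = (g + x * y * sin b) + b by ring.
    by rewrite [cos (_ + _ + b)]cosD; ring.
  (* The constant term disappears and the term of index k' + 1 becomes [x] times the term of index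
     k' with phase shifted by [b]: the sum loses one term, as the induction requires. *)
  have dk (k : 'I_n.+1) : is_derive y 1
      (fun s => (x * s) ^+ k / k`!%:R * cos (g + k%:R * b))
      (if k : nat is k'.+1 then
        x * ((x * y) ^+ k' / k'`!%:R * cos (g + b + k'%:R * b)) else 0).
    case: k => -[|k] /= kn.
      by under eq_fun do rewrite expr0; exact: is_derive_cst.
    have dX := is_derive_expMl R x y k.
    apply: is_derive_eq; rewrite /GRing.scale/=.
    have -> : g + k.+1%:R * b = g + b + k%:R * b by rewrite -natr1; ring.
    rewrite (invfact k).
    ring.
  have ds := is_derive_sum dk; apply: (is_derive_eq ds).
  by rewrite big_ord_recl/= add0r.
- have dX := is_derive_expMl R `|x| y n.
  rewrite /h /h'; apply: is_derive_eq; rewrite /GRing.scale/=.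
  rewrite (invfact n) exprS; ring.
- rewrite /f' /h' normrM ler_wpDr//.
    by rewrite !mulr_ge0 ?expR_ge0 ?exprn_ge0 ?invr_ge0 ?mulr_ge0.
  by rewrite ler_wpM2l// IH.
Qed.

(** * Real powers extended continuously to the line *)

(* [powR] takes the value 1 at negative bases; truncating makes the power
   continuous on the whole line. *)
Definition pospow {R : realType} (a t : R) : R := Num.max t 0 `^ a.

Lemma pospowE (R : realType) (a t : R) : 0 <= t -> pospow a t = t `^ a.
Proof. by move=> t0; rewrite /pospow max_l. Qed.

Lemma pospow_ge0 (R : realType) (a t : R) : 0 <= pospow a t.
Proof. exact: powR_ge0. Qed.

Lemma near_pospow (R : realType) (a t : R) : 0 < t ->
  \forall s \near t, s `^ a = pospow a s.
Proof.
by move=> t0; near=> s; rewrite pospowE// ltW//; near: s; exact: lt_nbhsr.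
Unshelve. end_near. Qed.

Lemma is_derive_pospow (R : realType) (a t : R) : 0 < t ->
  is_derive t 1 (pospow a) (a * t `^ (a - 1)).
Proof.
move=> t0; have h := near_pospow R a t t0.
exact: (near_eq_is_derive h (is_derive1_powR a t0)).
Qed.

Lemma continuous_pospow (R : realType) (a : R) : 0 < a -> continuous (pospow a).
Proof.
move=> a0 t; have [t0|t0|<-] := ltgtP 0 t.
- apply: differentiable_continuous; apply/derivable1_diffP.
  by have [] := is_derive_pospow _ a _ t0.
- have : \forall s \near t, 0 = pospow a s.
    near=> s; rewrite /pospow max_r ?powR0 ?gt_eqF//.
    by apply: ltW; near: s; exact: lt_nbhsl.
  move=> h; rewrite /continuous_at; have -> : pospow a t = 0 by rewrite -(nbhs_singleton h).
  by apply: cvg_trans (near_eq_cvg h) _; exact: cvg_cst.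
- have p0 : pospow a 0 = 0 by rewrite pospowE// powR0// gt_eqF.
  apply/left_right_continuousP; split.
  + rewrite p0; apply: (@cvg_trans _ ((fun=> 0 : R) @ 0^'-)); last exact: cvg_cst.
    apply: near_eq_cvg; near=> s.
    by rewrite /pospow max_r ?powR0 ?gt_eqF.
  + rewrite p0; apply: cvg_trans (powR_cvg0 a0); apply: near_eq_cvg.
    by near=> s; rewrite pospowE.
Unshelve. all: end_near. Qed.

(** * The rotated integrand and its two derivatives *)

(* For z = t e^{i phi} and t >= 0, [rot_re] and [rot_im] are the real and
   imaginary parts of i phi + i (x z + z^a / a). *)
Definition rot_re {R : realType} (a x phi t : R) : R :=
  - (x * t * sin phi) - pospow a t * sin (a * phi) / a.

Definition rot_im {R : realType} (a x phi t : R) : R :=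
  phi + x * t * cos phi + pospow a t * cos (a * phi) / a.

(* [rotA] = Re (e^{i phi} g(z)) and [rotB] = Re (i t e^{i phi} g(z)); [rotC] is
   both the phi-derivative of the former and the t-derivative of the latter. *)
Definition rotA {R : realType} (a x phi t : R) : R :=
  expR (rot_re a x phi t) * cos (rot_im a x phi t).

Definition rotB {R : realType} (a x phi t : R) : R :=
  - (t * expR (rot_re a x phi t) * sin (rot_im a x phi t)).

Definition rotC {R : realType} (a x phi t : R) : R :=
  expR (rot_re a x phi t) *
  (- (x * t * cos phi + pospow a t * cos (a * phi)) * cos (rot_im a x phi t)
   - (1 - x * t * sin phi - pospow a t * sin (a * phi)) * sin (rot_im a x phi t)).

Lemma is_derive_rotA (R : realType) (a x phi t : R) : 0 < a ->
  is_derive phi 1 (fun p => rotA a x p t) (rotC a x phi t).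
Proof.
move=> /lt0r_neq0 a0; rewrite /rotA /rotC /rot_re /rot_im.
apply: is_derive_eq; rewrite /GRing.scale/=; by field.
Qed.

(** Together with [is_derive_rotA], this is a Cauchy-Riemann equation in polar coordinates. *)
Lemma is_derive_rotB (R : realType) (a x phi t : R) : 0 < a -> 0 < t ->
  is_derive t 1 (rotB a x phi) (rotC a x phi t).
Proof.
move=> a0 t0; have /lt0r_neq0 a1 := a0; rewrite /rotB /rotC /rot_re /rot_im.
have dp := is_derive_pospow R a t t0.
apply: is_derive_eq; rewrite /GRing.scale/=.
have -> : pospow a t = t * t `^ (a - 1).
  by rewrite pospowE ?ltW// mulr_powRB1 ?ltW.
by field.
Qed.

Lemma continuous_rot_re (R : realType) (a x phi : R) : 0 < a ->
  continuous (rot_re a x phi).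
Proof.
move=> a0 t; apply: cvgB.
  apply: cvgN; apply: cvgM; last exact: cvg_cst.
  by apply: cvgM; [exact: cvg_cst|exact: cvg_id].
apply: cvgM; last exact: cvg_cst.
by apply: cvgM; [exact: continuous_pospow|exact: cvg_cst].
Qed.

Lemma continuous_rot_im (R : realType) (a x phi : R) : 0 < a ->
  continuous (rot_im a x phi).
Proof.
move=> a0 t; apply: cvgD.
  apply: cvgD; first exact: cvg_cst.
  apply: cvgM; last exact: cvg_cst.
  by apply: cvgM; [exact: cvg_cst|exact: cvg_id].
apply: cvgM; last exact: cvg_cst.
by apply: cvgM; [exact: continuous_pospow|exact: cvg_cst].
Qed.

Lemma continuous_rotA (R : realType) (a x phi : R) : 0 < a ->
  continuous (rotA a x phi).
Proof.
move=> a0 t; apply: cvgM.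
  by apply: continuous_comp; [exact: continuous_rot_re|exact: continuous_expR].
by apply: continuous_comp; [exact: continuous_rot_im|exact: continuous_cos].
Qed.

Lemma continuous_rotB (R : realType) (a x phi : R) : 0 < a ->
  continuous (rotB a x phi).
Proof.
move=> a0 t; apply: cvgN; apply: cvgM.
  apply: cvgM; first exact: cvg_id.
  by apply: continuous_comp; [exact: continuous_rot_re|exact: continuous_expR].
by apply: continuous_comp; [exact: continuous_rot_im|exact: continuous_sin].
Qed.

Lemma continuous_rotC (R : realType) (a x phi : R) : 0 < a ->
  continuous (rotC a x phi).
Proof.
move=> a0 t; have cxt c : x * s * c @[s --> t] --> x * t * c.
  apply: cvgM; last exact: cvg_cst.
  by apply: cvgM; [exact: cvg_cst|exact: cvg_id].
have cpt c : pospow a s * c @[s --> t] --> pospow a t * c.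
  by apply: cvgM; [exact: continuous_pospow|exact: cvg_cst].
apply: cvgM.
  by apply: continuous_comp; [exact: continuous_rot_re|exact: continuous_expR].
apply: cvgB; apply: cvgM.
- by apply: cvgN; apply: cvgD; [exact: cxt|exact: cpt].
- by apply: continuous_comp; [exact: continuous_rot_im|exact: continuous_cos].
- apply: cvgB; last exact: cpt.
  by apply: cvgB; [exact: cvg_cst|exact: cxt].
- by apply: continuous_comp; [exact: continuous_rot_im|exact: continuous_sin].
Qed.

(** * Differentiation of the rotated integral in the angle *)

(** A crude majorant of [rotC], uniform in the angle. Its growth in [t] is harmless, since it is
    integrated over compact intervals only. *)
Definition rot_bound {R : realType} (a x t : R) : R :=
  expR (`|x * t| + pospow a t) * (1 + 2 * (`|x * t| + pospow a t)).

Lemma norm_rotC_le (R : realType) (a x phi t : R) : 1 < a ->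
  `|rotC a x phi t| <= rot_bound a x t.
Proof.
move=> a1; rewrite /rotC /rot_bound normrM ger0_norm ?expR_ge0//.
have w0 := pospow_ge0 R a t; have c p := @cos_max R p; have s p := @sin_max R p.
set w := pospow a t in w0 *.
have wM z : `|z| <= 1 -> `|w * z| <= w.
  by move=> z1; rewrite normrM ger0_norm// ler_piMr.
have xM z : `|z| <= 1 -> `|x * t * z| <= `|x * t|.
  by move=> z1; rewrite normrM ler_piMr.
have le1M u v z : `|z| <= 1 -> `|u| <= v -> `|u * z| <= v.
  by move=> z1 uv; rewrite normrM; apply: le_trans uv; rewrite ler_piMr.
apply: ler_pM; rewrite ?expR_ge0//.
  rewrite ler_expR /rot_re -/w; apply: le_trans (ler_norm _) _.
  apply: le_trans (ler_normD _ _) _; rewrite !normrN lerD ?xM//.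
  rewrite normrM; apply: le_trans (wM _ (s (a * phi))).
  by rewrite ler_piMr// ger0_norm ?invr_ge0 ?invf_le1//; lra.
apply: le_trans (ler_normB _ _) _.
(* The two summands bound the coefficients of the cosine and of the sine. *)
have -> : 1 + 2 * (`|x * t| + w) = (`|x * t| + w) + (1 + (`|x * t| + w)) by ring.
apply: lerD; apply: le1M => //.
  by rewrite normrN; apply: le_trans (ler_normD _ _) _; rewrite lerD ?xM ?wM.
rewrite -addrA -opprD; apply: le_trans (ler_normB _ _) _.
rewrite normr1 lerD2l; apply: le_trans (ler_normD _ _) _.
by rewrite lerD ?xM ?wM.
Qed.

Lemma rot_bound_ge0 (R : realType) (a x t : R) : 0 <= rot_bound a x t.
Proof.
rewrite mulr_ge0 ?expR_ge0// addr_ge0// mulr_ge0// addr_ge0//.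
exact: pospow_ge0.
Qed.

Lemma continuous_rot_bound (R : realType) (a x : R) : 0 < a ->
  continuous (rot_bound a x).
Proof.
move=> a0 t; have cxp : `|x * s| + pospow a s @[s --> t] --> `|x * t| + pospow a t.
  apply: cvgD; last exact: continuous_pospow.
  by apply: cvg_norm; apply: cvgM; [exact: cvg_cst|exact: cvg_id].
apply: cvgM.
  exact: (cvg_comp _ _ cxp (@continuous_expR _ _)).
apply: cvgD; first exact: cvg_cst.
by apply: cvgM; [exact: cvg_cst|exact: cxp].
Qed.

Lemma integrable_itv_cc (R : realType) (f : R -> R) (b c : R) : continuous f ->
  lebesgue_measure.-integrable `[b, c] (EFin \o f).
Proof.
move=> cf; apply: continuous_compact_integrable; first exact: segment_compact.
exact: continuous_subspaceT.
Qed.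

(** Fundamental theorem of calculus in [t]: derivatives are taken inside the interval, continuity
    handles the ends, and the factor [t] of [rotB] kills the boundary term at 0. *)
Lemma integral_rotC (R : realType) (a x phi c : R) : 1 < a -> 0 < c ->
  \int[lebesgue_measure]_(t in `[0, c]) rotC a x phi t = rotB a x phi c.
Proof.
move=> a1 c0; have a0 : 0 < a by lra.
rewrite /Rintegral (@continuous_FTC2 _ _ (rotB a x phi)) //.
- by rewrite /rotB mul0r mul0r oppr0 sube0.
- by apply: continuous_subspaceT; exact: continuous_rotC.
- split.
  + move=> t; rewrite in_itv/= => /andP[t0 _].
    by have [] := is_derive_rotB R a x phi t a0 t0.
  + by apply: cvg_at_right_filter; exact: continuous_rotB.
  + by apply: cvg_at_left_filter; exact: continuous_rotB.
- move=> t; rewrite in_itv/= => /andP[t0 _].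
  have h := is_derive_rotB R a x phi t a0 t0.
  by rewrite derive1E derive_val.
Qed.

Lemma is_derive_integral_rotA (R : realType) (a x phi c : R) : 1 < a -> 0 < c ->
  is_derive phi 1
    (fun p => \int[lebesgue_measure]_(t in `[0, c]) rotA a x p t)
    (rotB a x phi c).
Proof.
move=> a1 c0; have a0 : 0 < a by lra.
(* The radius 1 is arbitrary, as [rot_bound] does not depend on the angle. *)
have phiI : `]phi - 1, phi + 1[%classic phi by rewrite /= in_itv/=; lra.
have intA (p : R) : `]phi - 1, phi + 1[%classic p ->
    lebesgue_measure.-integrable `[0, c] (EFin \o rotA a x p).
  by move=> _; apply: integrable_itv_cc; exact: continuous_rotA.
have dA (p t : R) : `]phi - 1, phi + 1[%classic p -> `[0, c]%classic t ->
    derivable (rotA a x ^~ t) p 1.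
  by move=> _ _; have [] := is_derive_rotA R a x p t a0.
have d1 p t : partial1of2 (rotA a x) p t = rotC a x p t.
  by have h := is_derive_rotA R a x p t a0; rewrite partial1of2E derive_val.
have intG : lebesgue_measure.-integrable `[0, c] (EFin \o rot_bound a x).
  by apply: integrable_itv_cc; exact: continuous_rot_bound.
have G_ub (p t : R) : `]phi - 1, phi + 1[%classic p -> `[0, c]%classic t ->
    `|partial1of2 (rotA a x) p t| <= rot_bound a x t.
  by move=> _ _; rewrite d1; exact: norm_rotC_le.
split.
  by apply: (derivable_under_integral _ phiI intA dA (rot_bound_ge0 R a x) intG G_ub).
rewrite -derive1E.
rewrite (differentiation_under_integral _ phiI intA dA (rot_bound_ge0 R a x) intG G_ub)//.
by rewrite -integral_rotC//; apply: eq_Rintegral => t _; exact: d1.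
Qed.

(** The estimate on the arc of radius [c]. At angle p the power contributes at most - c^a p / 2 to
    the exponent and the linear term at most |x| c p <= c^a p / 4, so the exponent is at most - p K
    with K = c^a / 4. Integrating c e^{- p K} over p >= 0 gives c / K. *)
Lemma rot_integral_sub (R : realType) (a x c : R) : 1 < a -> 0 < c ->
  4 * `|x| * c <= c `^ a ->
  `|\int[lebesgue_measure]_(t in `[0, c]) rotA a x (pi / (2 * a)) t
    - \int[lebesgue_measure]_(t in `[0, c]) rotA a x 0 t| <= 4 * c / c `^ a.
Proof.
move=> a1 c0 xc; have a0 : 0 < a by lra.
have pi0 := pi_gt0 R; have ca0 : 0 < c `^ a by rewrite powR_gt0.
pose K := c `^ a / 4; have K0 : 0 < K by rewrite /K; lra.
have th0 : 0 <= pi / (2 * a) by rewrite divr_ge0//; lra.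
(* A primitive in [p] of the bound c e^{- p K}. *)
pose g p := - (c / K * expR (- (p * K))).
have : g (pi / (2 * a)) - g 0 <= 4 * c / c `^ a.
  have -> : 4 * c / c `^ a = c / K by rewrite /K; field; lra.
  rewrite /g mul0r oppr0 expR0 mulr1 opprK gerDr oppr_le0.
  by rewrite mulr_ge0 ?expR_ge0// divr_ge0 ?ltW.
apply: le_trans.
apply: (@is_derive_norm_le R
  (fun p => \int[lebesgue_measure]_(t in `[0, c]) rotA a x p t) g (fun p => rotB a x p c)
  (fun p => c * expR (- (p * K)))) => //.
- by move=> p _; exact: is_derive_integral_rotA.
- move=> p _; rewrite /g; apply: is_derive_eq; rewrite /GRing.scale/=.
  by field; lra.
- move=> p /andP[p0 pth]; rewrite /rotB normrN normrM.
  have -> : c * expR (- (p * K)) = c * expR (- (p * K)) * 1 by rewrite mulr1.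
  rewrite ler_pM ?sin_max// normrM (ger0_norm (ltW c0)) ger0_norm ?expR_ge0//.
  rewrite ler_pM2l// ler_expR /rot_re (pospowE _ _ _ (ltW c0)).
  (* The final angle pi / (2 a) is the largest for which [sin_ge_half] applies to [a * p]. *)
  have ap : a * p <= pi / 2.
    have -> : pi / 2 = a * (pi / (2 * a)) by field; lra.
    by rewrite ler_pM2l.
  have s1 : a * p / 2 <= sin (a * p).
    by apply: sin_ge_half; rewrite ap mulr_ge0 ?(ltW a0).
  have s2 : `|x * c * sin p| <= `|x| * c * p.
    rewrite !normrM (ger0_norm (ltW c0)) ler_wpM2l ?norm_sin_le//.
    by rewrite mulr_ge0// ltW.
  have s3 : c `^ a * p / 2 <= c `^ a * sin (a * p) / a.
    rewrite ler_pdivlMr//.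
    have -> : c `^ a * p / 2 * a = c `^ a * (a * p / 2) by ring.
    by rewrite ler_pM2l.
  have := ler_wpM2r p0 xc.
  move: s2; rewrite ler_norml => /andP[s2 _].
  by rewrite /K; lra.
Qed.

(** * Integrability on the half-line *)

(** Dominated convergence along any sequence [u] tending to infinity: the truncations of [f] to
    [[b, u n]] are bounded by [|f|] and eventually constant at each point. *)
Lemma Rintegral_cvgy (R : realType) (f : R -> R) (b : R) :
  lebesgue_measure.-integrable `[b, +oo[ (EFin \o f) ->
  \int[lebesgue_measure]_(t in `[b, c]) f t @[c --> +oo] -->
  \int[lebesgue_measure]_(t in `[b, +oo[) f t.
Proof.
move=> intf; apply/cvg_pinftyP => u uy.
have /integrableP[mf _] := intf.
have -> : (fun n => \int[lebesgue_measure]_(t in `[b, u n]) f t) =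
    (fun n => \int[lebesgue_measure]_(t in `[b, +oo[) (f \_ `[b, u n]) t).
  apply/funext => n; rewrite -Rintegral_mkcondr; congr Rintegral.
  apply/seteqP; split=> t /=; rewrite !in_itv/=.
    by move=> /andP[-> ->].
  by move=> [_].
apply: fine_cvg; rewrite fineK; last exact: integrable_fin_num.
apply: (@dominated_cvg _ _ _ lebesgue_measure _ _ _ _ (fun t => `|f t|%:E)) => //.
- move=> n; apply/measurable_EFinP.
  apply/(measurable_restrict f (measurable_itv _) (measurable_itv _)).
  apply: measurable_funS (@subIsetl _ _ _) _ => //.
  exact/measurable_EFinP.
- move=> t; rewrite /= in_itv/= andbT => bt; apply: cvg_EFin; first exact: nearW.
  have uge A : \forall n \near \oo, A <= u n by move: A; apply/cvgryPge.
  apply: cvg_near_cst; near=> n; rewrite /= patchE mem_set//= in_itv/= bt/=.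
  by near: n; exact: uge.
- exact: integrable_abse intf.
- move=> n t _; rewrite lee_fin patchE; case: ifP => // _.
  by rewrite normr0.
Unshelve. all: end_near. Qed.

Lemma integrable_expRN (R : realType) (C : R) :
  lebesgue_measure.-integrable `[0, +oo[ (EFin \o (fun t : R => C * expR (- t))).
Proof.
have h : lebesgue_measure.-integrable `[0, +oo[
    (EFin \o (fun t : R => expR (- t))).
  have h1 := @integrable_exponential_pdf R 1 ltr01.
  have h2 : lebesgue_measure.-integrable `[0, +oo[ (EFin \o @exponential_pdf R 1).
    by apply: integrableS h1.
  apply: eq_integrable h2 => // t; rewrite inE/= in_itv/= andbT => t0.
  by rewrite /= exponential_pdfE// mul1r mulN1r.
by apply: integrableZl h.
Qed.

(** Young's inequality for the conjugate exponents a and a / (a - 1): t^a / a absorbs any linear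
    growth. *)
Lemma young_pospow (R : realType) (a b : R) : 1 < a -> 0 <= b ->
  exists C, forall t, 0 <= t -> b * t <= pospow a t / a + C.
Proof.
move=> a1 b0; exists (b `^ (a / (a - 1)) / (a / (a - 1))) => t t0.
rewrite pospowE// mulrC; apply: conjugate_powR => //; first lra.
  by rewrite divr_gt0; lra.
by field; lra.
Qed.

Lemma continuous_expR_pospow (R : realType) (a y : R) : 0 < a ->
  continuous (fun t => expR (y * t - pospow a t / a)).
Proof.
move=> a0 t; have c : y * s - pospow a s / a @[s --> t] --> y * t - pospow a t / a.
  apply: cvgB; first by apply: cvgM; [exact: cvg_cst|exact: cvg_id].
  by apply: cvgM; [exact: continuous_pospow|exact: cvg_cst].
exact: (cvg_comp _ _ c (@continuous_expR _ _)).
Qed.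

Lemma integrable_expR_pospow (R : realType) (a y : R) : 1 < a ->
  lebesgue_measure.-integrable `[0, +oo[
    (EFin \o (fun t => expR (y * t - pospow a t / a))).
Proof.
(* The slope [|y| + 1] absorbs [y * t] and leaves a spare e^{-t}, whence the majorant e^C e^{-t}. *)
move=> a1; have [C hC] := @young_pospow R a (`|y| + 1) a1 ltac:(by rewrite addr_ge0).
apply: le_integrable (integrable_expRN R (expR C)) => //.
- apply/measurable_EFinP; apply: measurable_funTS.
  apply: continuous_measurable_fun; apply: continuous_expR_pospow; lra.
- move=> t; rewrite /= in_itv/= andbT => t0.
  rewrite lee_fin !ger0_norm ?mulr_ge0 ?expR_ge0// -expRD ler_expR.
  have := hC t t0; have : y * t <= `|y| * t by rewrite ler_wpM2r// ler_norm.
  lra.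
Qed.

Lemma exprn_le_expR (R : realType) (y : R) (n : nat) : 0 <= y ->
  y ^+ n / n`!%:R <= expR y.
Proof.
case: n => [|n] y0; last by apply: le_trans (expR_ge1Dxn n y0); lra.
by rewrite expr0 fact0 divr1; have := expR_ge1Dx y; lra.
Qed.

(** Since t^n <= n! e^t, the case [y = 1] of [integrable_expR_pospow] dominates. *)
Lemma integrable_moment (R : realType) (a : R) (n : nat) : 1 < a ->
  lebesgue_measure.-integrable `[0, +oo[
    (EFin \o (fun t => t ^+ n * expR (- (pospow a t / a)))).
Proof.
move=> a1.
have h := integrable_expR_pospow R a 1 a1.
apply: le_integrable (integrableZl _ n`!%:R h) => //.
- apply/measurable_EFinP; apply: measurable_funTS.
  apply: continuous_measurable_fun => t.
  apply: cvgM; first exact: exprn_continuous.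
  have := @continuous_expR_pospow R a 0 ltac:(lra) t.
  by under eq_fun do rewrite mul0r add0r.
- move=> t; rewrite /= in_itv/= andbT => t0.
  rewrite lee_fin !ger0_norm ?mulr_ge0 ?exprn_ge0 ?expR_ge0//.
  rewrite mul1r expRD mulrA ler_wpM2r ?expR_ge0//.
  rewrite mulrC -ler_pdivrMr ?exprn_le_expR//.
Qed.

(** * Change of variable and Gamma moments *)

(** Substitution t = (a u)^{1/a}, that is u = t^a / a. Keeping [b] positive avoids the point 0,
    where the derivative (a u)^{1/a - 1} may blow up. *)
Lemma integral_substitution_root (R : realType) (a b c : R) (G : R -> R) :
  0 < a -> 0 < b -> b <= c -> continuous G ->
  (\int[lebesgue_measure]_(t in `[((a * b) `^ a^-1)%R, ((a * c) `^ a^-1)%R]) (G t)%:E =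
   \int[lebesgue_measure]_(u in `[b, c])
     (G ((a * u) `^ a^-1) * (a * u) `^ (a^-1 - 1))%R%:E)%E.
Proof.
move=> a0 b0 bc cG; have a1 : 0 < a^-1 by rewrite invr_gt0.
pose F u := (a * u) `^ a^-1; pose F' u := (a * u) `^ (a^-1 - 1).
(* Used with p = 1/a to differentiate [F], and with p = 1/a - 1 for the continuity of [F']. *)
have dpow (p u : R) : 0 < u -> is_derive u 1 (fun u => (a * u) `^ p)
    (a * p * (a * u) `^ (p - 1)).
  move=> u0; have au0 : 0 < a * u by rewrite mulr_gt0.
  have d1 : is_derive u 1 (fun v => a * v) a.
    by apply: is_derive_eq; rewrite /GRing.scale/=; ring.
  have d2 := is_derive1_powR p au0.
  by apply: is_derive_eq (is_derive1_comp d2 d1) _; ring.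
have dF (u : R) : 0 < u -> is_derive u 1 F (F' u).
  by move=> u0; apply: is_derive_eq (dpow a^-1 u u0) _; rewrite divff ?mul1r// gt_eqF.
have F'E (u : R) : 0 < u -> (F^`()%classic) u = F' u.
  by move=> u0; have h := dF u u0; rewrite derive1E derive_val.
have cF' (u : R) : 0 < u -> {for u, continuous (F^`()%classic)}.
  move=> u0; rewrite /prop_for /continuous_at F'E//.
  have : F' @ u --> F' u.
    apply: differentiable_continuous; apply/derivable1_diffP.
    by have [] := dpow (a^-1 - 1) u u0.
  apply: cvg_trans; apply: near_eq_cvg; near=> v; rewrite F'E//.
  by near: v; exact: lt_nbhsr.
have cF (u : R) : 0 < u -> {for u, continuous F}.
  move=> u0; apply: differentiable_continuous; apply/derivable1_diffP.
  by have [] := dF u u0.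
have c0 : 0 < c by exact: lt_le_trans bc.
rewrite (@integration_by_substitution_increasing _ F G b c bc).
- apply: eq_integral => u; rewrite inE/= in_itv/= => /andP[bu _].
  by rewrite fctE F'E// (lt_le_trans b0).
- move=> u v; rewrite !in_itv/= => /andP[bu _] /andP[bv _] uv.
  apply: gt0_ltr_powR => //; rewrite ?nnegrE ?mulr_ge0 ?ltr_pM2l ?ltW//.
  + by rewrite (lt_le_trans b0).
  + by rewrite (lt_le_trans b0).
- move=> u; rewrite in_itv/= => /andP[bu _]; apply: cF'; exact: lt_trans bu.
- apply/cvg_ex; exists ((F^`()%classic) b); apply: cvg_at_right_filter; exact: cF'.
- apply/cvg_ex; exists ((F^`()%classic) c); apply: cvg_at_left_filter; exact: cF'.
- split.
  + move=> u; rewrite in_itv/= => /andP[bu _].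
    by have [] := dF u (lt_trans b0 bu).
  + by apply: cvg_at_right_filter; exact: cF.
  + by apply: cvg_at_left_filter; exact: cF.
- exact: continuous_subspaceT.
Unshelve. all: end_near. Qed.

(* The integrand on the right may be singular at 0, hence the exhaustion by
   compact intervals. *)
Lemma integral_itv0y_root (R : realType) (a : R) (G : R -> R) :
  0 < a -> continuous G -> (forall t, 0 < t -> 0 <= G t) ->
  (\int[lebesgue_measure]_(t in `]0%R, +oo[) (G t)%:E =
   \int[lebesgue_measure]_(u in `]0%R, +oo[)
     (G ((a * u) `^ a^-1) * (a * u) `^ (a^-1 - 1))%R%:E)%E.
Proof.
move=> a0 cG G0; have a1 : 0 < a^-1 by rewrite invr_gt0.
pose F u := (a * u) `^ a^-1.
pose H u := G (F u) * (a * u) `^ (a^-1 - 1).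
have F_le u v : 0 <= u -> u <= v -> F u <= F v.
  move=> u0 uv; apply: ge0_ler_powR; rewrite ?nnegrE ?mulr_ge0 ?ler_pM2l//.
  - exact: ltW.
  - exact: ltW.
  - exact: ltW.
  - exact: le_trans uv.
have F_gt0 u : 0 < u -> 0 < F u by move=> u0; rewrite powR_gt0// mulr_gt0.
(* The intervals [1 / (n + 1), n + 1] and their images under [F] both increase to the open
   half-line, so monotone convergence applies on either side. *)
pose l n : R := n.+1%:R^-1; pose r n : R := n.+1%:R.
have l_gt0 n : 0 < l n by rewrite invr_gt0.
have lr n : l n <= r n.
  by apply: (@le_trans _ _ 1); rewrite ?invf_le1 ?ler1n.
pose D n := `[l n, r n]%classic; pose E n := `[F (l n), F (r n)]%classic.
have mono m n : (m <= n)%N -> l n <= l m /\ r m <= r n.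
  by move=> mn; rewrite lef_pV2 ?posrE ?ler_nat.
have DE : \bigcup_n D n = `]0, +oo[%classic.
  apply/seteqP; split=> u /=.
    by move=> [n _]; rewrite /D /= !in_itv/= andbT => /andP[lu _]; exact: lt_le_trans lu.
  rewrite in_itv/= andbT => u0.
  near \oo => n; exists n => //; rewrite /D/= in_itv/=; apply/andP; split.
    rewrite /l -[leRHS]invrK lef_pV2 ?posrE ?invr_gt0//.
    apply: (@le_trans _ _ n%:R); last by rewrite ler_nat.
    by near: n; exact: nbhs_infty_ger.
  apply: (@le_trans _ _ n%:R); last by rewrite ler_nat.
  by near: n; exact: nbhs_infty_ger.
have EE : \bigcup_n E n = `]0, +oo[%classic.
  apply/seteqP; split=> t /=.
    move=> [n _]; rewrite /E /= !in_itv/= andbT => /andP[lu _].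
    exact: lt_le_trans (F_gt0 _ (l_gt0 n)) lu.
  rewrite in_itv/= andbT => t0.
  (* The preimage of [t] under [F]; the index that covers it also covers [t]. *)
  have u0 : `]0, +oo[%classic (t `^ a / a) by rewrite /= in_itv/= andbT divr_gt0// powR_gt0.
  have tF : t = F (t `^ a / a).
    rewrite /F mulrC divfK ?gt_eqF// -powRrM divff ?gt_eqF//.
    by rewrite powRr1// ltW.
  move: u0; rewrite -DE => -[n _]; rewrite /D/= in_itv/= => /andP[lu ur].
  exists n => //; rewrite /E/= in_itv/= tF !F_le ?divr_ge0 ?powR_ge0 ?(ltW a0)//.
  exact: ltW.
have cvgE : (\int[lebesgue_measure]_(t in E n) (G t)%:E @[n --> \oo] -->
    \int[lebesgue_measure]_(t in `]0%R, +oo[) (G t)%:E)%E.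
  rewrite -EE; apply: ge0_nondecreasing_set_cvg_integral => //.
  - move=> m n /mono[lnm rmn]; rewrite subsetEset /E; apply: subset_itvScc.
      by rewrite bnd_simp F_le// ltW.
    by rewrite bnd_simp F_le//; rewrite ler0n.
  - by move=> n; exact: measurable_itv.
  - move=> n; apply/measurable_EFinP; apply: measurable_funTS.
    exact: continuous_measurable_fun.
  - move=> n t; rewrite /E/= in_itv/= => /andP[lt _].
    by rewrite lee_fin G0// (lt_le_trans _ lt)// F_gt0.
have cvgD : (\int[lebesgue_measure]_(u in D n) (H u)%:E @[n --> \oo] -->
    \int[lebesgue_measure]_(u in `]0%R, +oo[) (H u)%:E)%E.
  rewrite -DE; apply: ge0_nondecreasing_set_cvg_integral => //.
  - move=> m n /mono[lnm rmn]; rewrite subsetEset /D.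
    by apply: subset_itvScc; rewrite bnd_simp.
  - by move=> n; exact: measurable_itv.
  - move=> n; apply/measurable_EFinP; apply: measurable_funTS.
    have mM p : measurable_fun [set: R] (fun u => (a * u) `^ p).
      by apply: (measurableT_comp (measurable_powR _)).
    apply: measurable_funM; last exact: mM.
    by apply: (measurableT_comp (continuous_measurable_fun cG)) => //; exact: mM.
  - move=> n u; rewrite /D/= in_itv/= => /andP[lu _].
    have u0 : 0 < u by exact: lt_le_trans lu.
    by rewrite lee_fin mulr_ge0 ?powR_ge0// G0// F_gt0.
have ED : (fun n => \int[lebesgue_measure]_(t in E n) (G t)%:E)%E =
    (fun n => \int[lebesgue_measure]_(u in D n) (H u)%:E)%E.
  by apply/funext => n; exact: integral_substitution_root.
rewrite ED in cvgE.
exact: (cvg_unique _ cvgE cvgD).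
Unshelve. all: end_near. Qed.

(** Under u = t^a / a, t^k dt becomes (a u)^{(k+1)/a - 1} du and the weight becomes e^{-u}. *)
Lemma integral_moment (R : realType) (a : R) (k : nat) : 1 < a ->
  \int[lebesgue_measure]_(t in `[0, +oo[) (t ^+ k * expR (- (pospow a t / a))) =
  a `^ (k.+1%:R / a - 1) * Gamma (k.+1%:R / a).
Proof.
move=> a1; have a0 : 0 < a by lra.
pose G (t : R) := t ^+ k * expR (- (pospow a t / a)).
have cG : continuous G.
  move=> t; apply: cvgM; first exact: exprn_continuous.
  have := @continuous_expR_pospow R a 0 a0 t.
  by under eq_fun do rewrite mul0r add0r.
rewrite /Gamma /Rintegral -/(G _) -integral_itv_obnd_cbnd; last first.
  apply/measurable_EFinP; apply: measurable_funTS.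
  exact: continuous_measurable_fun.
rewrite (@integral_itv0y_root R a G a0 cG); last first.
  by move=> t t0; rewrite mulr_ge0 ?expR_ge0// exprn_ge0// ltW.
have -> : (\int[lebesgue_measure]_(u in `]0%R, +oo[)
     (G ((a * u) `^ a^-1) * (a * u) `^ (a^-1 - 1))%R%:E)%E =
  (\int[lebesgue_measure]_(u in `]0%R, +oo[) ((a `^ (k.+1%:R / a - 1))%:E *
     (u `^ (k.+1%:R / a - 1) * expR (- u))%R%:E))%E.
  apply: eq_integral => u; rewrite inE/= in_itv/= andbT => u0.
  have au0 : 0 < a * u by rewrite mulr_gt0.
  rewrite -EFinM /G pospowE ?powR_ge0//; congr EFin.
  rewrite -powR_mulrn ?powR_ge0// -!powRrM mulVf ?gt_eqF// powRr1 ?ltW//.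
  have -> : a * u / a = u by field; lra.
  rewrite mulrAC -powRD; last by rewrite (gt_eqF au0) implybT.
  rewrite mulrA -powRM ?ltW//; congr (_ `^ _ * _).
  by rewrite -natr1; ring.
rewrite ge0_integralZl//=.
(* The factor is pulled out of [fine]; in the infinite cases [c > 0] keeps the product infinite and
   both sides take the default value 0. *)
- set c := a `^ _; have c0 : 0 < c by exact: powR_gt0.
  case: (\int[_]_(_ in _) _)%E => [z||] /=; first by [].
    by rewrite mulr0 gt0_muley ?lte_fin.
  by rewrite mulr0 gt0_muleNy ?lte_fin.
- apply/measurable_EFinP; apply: measurable_funM.
    by apply: measurable_funTS; exact: measurable_powR.
  apply: measurable_funTS; apply: continuous_measurable_fun => t.
  have ct : - s @[s --> t] --> - t by apply: cvgN; exact: cvg_id.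
  exact: (cvg_comp _ _ ct (@continuous_expR _ _)).
- by move=> u _; rewrite lee_fin mulr_ge0 ?powR_ge0 ?expR_ge0.
- by rewrite lee_fin powR_ge0.
Qed.

(** * Termwise integration on the final ray *)

Lemma expR_cos_series (R : realType) (x b t g : R) : 0 <= t ->
  \sum_(k < n) (x * t) ^+ k / k`!%:R * cos (g + k%:R * b) @[n --> \oo] -->
  expR (x * t * cos b) * cos (g + x * t * sin b).
Proof.
move=> t0; apply/subr_cvg0.
have c0 : expR (`|x| * t) * ((`|x| * t) ^+ n / n`!%:R) @[n --> \oo] --> 0.
  rewrite -(mulr0 (expR (`|x| * t))); apply: cvgM; first exact: cvg_cst.
  exact: (cvg_exp_coeff (`|x| * t)).
apply/norm_cvg0P; apply: squeeze_cvgr (cvg_cst 0) c0.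
by apply: nearW => n; rewrite normr_ge0 distrC expR_cos_taylor.
Qed.

(** A bound free of [n], as dominated convergence requires. The partial sum is the full function,
    bounded by the Taylor estimate of order 0, minus the remainder of order [n]. *)
Lemma norm_expR_cos_sum_le (R : realType) (x b t g : R) (n : nat) : 0 <= t ->
  `|\sum_(k < n) (x * t) ^+ k / k`!%:R * cos (g + k%:R * b)| <=
  2 * expR (2 * `|x| * t).
Proof.
move=> t0; have xt0 : 0 <= `|x| * t by rewrite mulr_ge0.
have := expR_cos_taylor R x b n t g t0.
set u := expR (x * t * cos b) * _; set S := \sum_(k < n) _ => uS.
have ule : `|u| <= expR (2 * `|x| * t).
  have := expR_cos_taylor R x b 0 t g t0; rewrite -/u big_ord0 subr0 => h.
  apply: le_trans h _; rewrite expr0 fact0 divr1 mulr1 ler_expR -mulrA.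
  lra.
have rle : expR (`|x| * t) * ((`|x| * t) ^+ n / n`!%:R) <= expR (2 * `|x| * t).
  have -> : 2 * `|x| * t = `|x| * t + `|x| * t by ring.
  by rewrite expRD ler_wpM2l ?expR_ge0// exprn_le_expR.
have -> : S = u - (u - S) by ring.
by apply: le_trans (ler_normB _ _) _; lra.
Qed.

(** Here a th = pi / 2, so the power gives pure decay and leaves the phase; with b = th + pi / 2, i
    x z = x t e^{i b}, the form expanded by [expR_cos_taylor]. *)
Lemma rotA_end (R : realType) (a x t : R) : 0 < a ->
  let th := pi / (2 * a) in
  rotA a x th t = expR (x * t * cos (th + pi / 2)) *
    cos (th + x * t * sin (th + pi / 2)) * expR (- (pospow a t / a)).
Proof.
move=> a0 th; rewrite /rotA /rot_re /rot_im.
have -> : a * th = pi / 2 by rewrite /th; field; lra.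
rewrite sin_pihalf cos_pihalf mulr0 mul0r addr0 mulr1 cosDpihalf sinDpihalf.
by rewrite expRD mulrN; ring.
Qed.

(** With th = pi / (2 a), the real part of e^{i th} (i x e^{i th})^k / k!. *)
Definition rot_coeff {R : realType} (a x : R) (k : nat) : R :=
  x ^+ k / k`!%:R * cos (pi / (2 * a) + k%:R * (pi / (2 * a) + pi / 2)).

Lemma integral_rot_sum (R : realType) (a x : R) (n : nat) : 1 < a ->
  let f t := \sum_(k < n) rot_coeff a x k * (t ^+ k * expR (- (pospow a t / a))) in
  lebesgue_measure.-integrable `[0, +oo[ (EFin \o f) /\
  \int[lebesgue_measure]_(t in `[0, +oo[) f t =
  \sum_(k < n) rot_coeff a x k * (a `^ (k.+1%:R / a - 1) * Gamma (k.+1%:R / a)).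
Proof.
move=> a1 /=; elim: n => [|n [IH1 IH2]].
  split; last by rewrite big_ord0; under eq_Rintegral do rewrite big_ord0; rewrite Rintegral_cst// mul0r.
  under [X in EFin \o X]eq_fun do rewrite big_ord0.
  exact: integrable0.
have h := integrable_moment R a n a1.
have h2 : lebesgue_measure.-integrable `[0, +oo[
    (EFin \o (fun t => rot_coeff a x n * (t ^+ n * expR (- (pospow a t / a))))).
  by apply: integrableZl h.
split.
  under [X in EFin \o X]eq_fun do rewrite big_ord_recr/=.
  by apply: integrableD IH1 h2.
rewrite big_ord_recr/=; under eq_Rintegral do rewrite big_ord_recr/=.
rewrite RintegralD// IH2; congr (_ + _).
by rewrite RintegralZl// integral_moment.
Qed.

(** Dominated convergence of the partial sums, with majorant 2 exp (2 |x| t - t^a / a); the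
    convergence of the series comes with it. *)
Lemma rot_series_cvg (R : realType) (a x : R) : 1 < a ->
  lebesgue_measure.-integrable `[0, +oo[ (EFin \o rotA a x (pi / (2 * a))) /\
  \sum_(k < n) rot_coeff a x k * (a `^ (k.+1%:R / a - 1) * Gamma (k.+1%:R / a))
    @[n --> \oo] -->
  \int[lebesgue_measure]_(t in `[0, +oo[) rotA a x (pi / (2 * a)) t.
Proof.
move=> a1; have a0 : 0 < a by lra.
set th := pi / (2 * a); pose b := th + pi / 2.
pose f n t := \sum_(k < n) rot_coeff a x k * (t ^+ k * expR (- (pospow a t / a))).
have fE n t : f n t = (\sum_(k < n) (x * t) ^+ k / k`!%:R * cos (th + k%:R * b))
    * expR (- (pospow a t / a)).
  rewrite /f mulr_suml; apply: eq_bigr => k _; rewrite /rot_coeff -/th -/b exprMn.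
  by ring.
have intf n : lebesgue_measure.-integrable `[0, +oo[ (EFin \o f n).
  by have [] := integral_rot_sum R a x n a1.
pose G t := 2 * expR (2 * `|x| * t - pospow a t / a).
have intG : lebesgue_measure.-integrable `[0, +oo[ (EFin \o G).
  by apply: integrableZl (integrable_expR_pospow R a (2 * `|x|) a1).
have f_cvg t : `[0, +oo[%classic t ->
    (f n t)%:E @[n --> \oo] --> (rotA a x th t)%:E.
  rewrite /= in_itv/= andbT => t0; apply: cvg_EFin; first exact: nearW.
  under eq_fun do rewrite /= fE; rewrite rotA_end//.
  by apply: cvgM; [exact: expR_cos_series|exact: cvg_cst].
have f_le n t : `[0, +oo[%classic t -> (`|(f n t)%:E| <= (G t)%:E)%E.
  rewrite /= in_itv/= andbT => t0.
  rewrite lee_fin fE normrM (ger0_norm (expR_ge0 _)) /G expRD mulrA.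
  by rewrite ler_wpM2r ?expR_ge0// norm_expR_cos_sum_le.
have [||||||ir _ cr] := @dominated_convergence _ _ _ lebesgue_measure `[0, +oo[
  _ (fun n => EFin \o f n) (EFin \o rotA a x th) (EFin \o G).
- exact: measurable_itv.
- by move=> n; have /integrableP[] := intf n.
- apply/measurable_EFinP; apply: measurable_funTS.
  by apply: continuous_measurable_fun; exact: continuous_rotA.
- exact: aeW.
- exact: intG.
- by apply: aeW => t n; exact: f_le.
split=> //.
have -> : (fun n => \sum_(k < n) rot_coeff a x k *
    (a `^ (k.+1%:R / a - 1) * Gamma (k.+1%:R / a))) =
    (fun n => \int[lebesgue_measure]_(t in `[0, +oo[) f n t).
  by apply/funext => n; have [_ ->] := integral_rot_sum R a x n a1.
apply: fine_cvg; rewrite fineK; first exact: cr.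
exact: integrable_fin_num.
Qed.

(** The sine argument is (k + 1) (th + pi / 2) with th = pi / (2 a), which is the phase in
    [rot_coeff] plus pi / 2; the powers of [a] match as k / a = (a - 1) / a + ((k + 1) / a - 1). *)
Lemma Airy_termE (R : realType) (a x : R) (k : nat) : 1 < a ->
  Airy_term a x k = a `^ ((a - 1) / a) *
    (rot_coeff a x k * (a `^ (k.+1%:R / a - 1) * Gamma (k.+1%:R / a))).
Proof.
move=> a1; have a0 : 0 < a by lra.
rewrite /Airy_term /rot_coeff.
have -> : pi * (k.+1%:R * (a + 1)) / (2 * a) =
    pi / (2 * a) + k%:R * (pi / (2 * a) + pi / 2) + pi / 2.
  by rewrite -natr1; field; lra.
rewrite sinDpihalf.
have -> : a `^ (k%:R / a) = a `^ ((a - 1) / a) * a `^ (k.+1%:R / a - 1).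
  rewrite -powRD; last by rewrite (gt_eqF a0) implybT.
  by congr powR; rewrite -natr1; field; lra.
by ring.
Qed.

(** * Passage to the limit and conclusion *)

(** Writing c^a = c c^{a-1} turns both the hypothesis and the smallness of the arc bound into lower
    bounds on c^{a-1}, which tends to infinity as a > 1. *)
Lemma rot_integral_sub_cvg (R : realType) (a x : R) : 1 < a ->
  \int[lebesgue_measure]_(t in `[0, c]) rotA a x (pi / (2 * a)) t
    - \int[lebesgue_measure]_(t in `[0, c]) rotA a x 0 t @[c --> +oo] --> 0.
Proof.
move=> a1; have a0 : 0 < a by lra.
have big (A : R) : \forall c \near +oo, A <= c `^ (a - 1).
  have a10 : 0 < a - 1 by lra.
  pose A' := `|A| `^ (a - 1)^-1; near=> c.
  apply: (le_trans (ler_norm A)).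
  have -> : `|A| = A' `^ (a - 1) by rewrite -powRrM mulVf ?gt_eqF// powRr1.
  have A'c : A' <= c by near: c; exact: nbhs_pinfty_ge (num_real _).
  apply: ge0_ler_powR => //; rewrite ?nnegrE ?powR_ge0 ?(ltW a10)//.
have cE (c : R) : 0 < c -> c `^ a = c * c `^ (a - 1).
  by move=> c0; rewrite mulr_powRB1// ltW.
apply/cvgr0Pnorm_le => e e0; near=> c.
have c0 : 0 < c by near: c; exact: nbhs_pinfty_gt (num_real _).
have c1 : 4 * `|x| <= c `^ (a - 1) by near: c; exact: big.
have c2 : 4 / e <= c `^ (a - 1) by near: c; exact: big.
apply: le_trans (rot_integral_sub R a x c a1 c0 _) _.
  by rewrite cE// mulrC ler_pM2l.
rewrite ler_pdivrMr ?powR_gt0// cE//.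
have -> : e * (c * c `^ (a - 1)) = c `^ (a - 1) * e * c by ring.
by rewrite ler_pM2r// -ler_pdivrMr.
Unshelve. all: end_near. Qed.

Lemma Airy_integralE (R : realType) (a x c : R) :
  Airy_integral a x c = \int[lebesgue_measure]_(t in `[0, c]) rotA a x 0 t.
Proof.
apply: eq_Rintegral => t; rewrite inE/= in_itv/= => /andP[t0 _].
rewrite /rotA /rot_re /rot_im mulr0 sin0 cos0 !mulr0 mul0r subr0 oppr0 expR0 mul1r.
by rewrite add0r !mulr1 pospowE.
Qed.

Theorem theorem4 (R : realType) (alpha : R) (halpha : 1 < alpha) (x : R) :
  [/\ cvg (Airy_integral alpha x c @[c --> +oo]),
      cvgn (series (Airy_term alpha x)) &
      Airy alpha x =
        1 / (pi * alpha `^ ((alpha - 1) / alpha))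
        * limn (series (Airy_term alpha x))].
Proof.
have [intA sumA] := rot_series_cvg R alpha x halpha.
set L := \int[_]_(_ in _) _ in sumA.
have cA : Airy_integral alpha x c @[c --> +oo] --> L.
  pose I phi (c : R) := \int[lebesgue_measure]_(t in `[0, c]) rotA alpha x phi t.
  (* The integral on the final ray tends to [L], and the difference between the two rays vanishes in
     the limit. *)
  have -> : Airy_integral alpha x =
      (fun c => I (pi / (2 * alpha)) c - (I (pi / (2 * alpha)) c - I 0 c)).
    by apply/funext => c; rewrite Airy_integralE /I; ring.
  rewrite -[L]subr0; apply: cvgB; first exact: Rintegral_cvgy.
  exact: rot_integral_sub_cvg.
set C := alpha `^ ((alpha - 1) / alpha).
have C0 : 0 < C by rewrite powR_gt0; lra.
have cS : series (Airy_term alpha x) @ \oo --> C * L.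
  have -> : series (Airy_term alpha x) = (fun n => C * \sum_(k < n)
      rot_coeff alpha x k *
      (alpha `^ (k.+1%:R / alpha - 1) * Gamma (k.+1%:R / alpha))).
    apply/funext => n; rewrite seriesEord mulr_sumr; apply: eq_bigr => k _.
    exact: Airy_termE.
  by apply: cvgM; [exact: cvg_cst|exact: sumA].
split; [by apply/cvg_ex; exists L|by apply/cvg_ex; exists (C * L)|].
rewrite /Airy (cvg_lim _ cA)// (cvg_lim _ cS)//.
have := pi_gt0 R; move: (pi : R) => p p0.
by field; rewrite !gt_eqF.
Qed.
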